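(* For every integer $\Delta\ge1$ and every $\epsilon>0$ there exist a packing mixed integer linear program $(\mathrm{P})$ with $z^I>0$ and a partition $\mathcal{J}$ of its variable indices such that the packing interaction graph $G^{\mathrm{pack}}_{A,\mathcal{J}}$ is a star with maximum degree $\Delta$ and $$z^{N.S.}\ge\left(\frac{2\Delta-1}{\Delta}-\epsilon\right)z^I .$$
   Context: $[n]=\{1,\dots,n\}$. The packing problem $(\mathrm{P})$ is: maximize $c^Tx$ subject to $Ax\le b$, $x_j\in\mathbb{Z}_+$ for $j\in\mathcal{L}$, $x_j\in\mathbb{R}_+$ for $j\in[n]\setminus\mathcal{L}$, where $A\in\mathbb{Q}_+^{m\times n}$, $b\in\mathbb{Q}_+^m$, $c\in\mathbb{Q}_+^n$, $\mathcal{L}\subseteq[n]$. Let $P$ be its feasible region, $P^I$ the convex hull of $P$, and $P^{LP}$ the feasible region of its linear programming relaxation; $z^I=\max\{c^Tx:x\in P^I\}$. Sparse closures: for $N\subseteq[n]$, a sparse cut on $N$ is an inequality $\alpha^Tx\le\beta$ valid for $P^I$ with $\alpha_i=0$ for all $i\notin N$; $P^{(N)}$ is the set of points of $P^{LP}$ satisfying all sparse cuts on $N$. For a partition $\mathcal{J}=\{J_1,\dots,J_q\}$ of $[n]$, the packing interaction graph $G^{\mathrm{pack}}_{A,\mathcal{J}}$ has one node $v_j$ for each block $J_j$, and distinct nodes $v_i,v_j$ are adjacent iff some row of $A$ has a nonzero entry in a column of $J_i$ and a nonzero entry in a column of $J_j$. A star with maximum degree $\Delta$ is a graph with $\Delta+1$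 nodes consisting of a center adjacent to $\Delta$ leaves and no other edges. Natural sparse closure: for each row $i\in[m]$ let $N_i$ be the union of those blocks $J_u$ for which row $i$ of $A$ has a nonzero entry in some column of $J_u$. Then $P^{N.S.}:=\bigcap_{i=1}^mP^{(N_i)}$ and $z^{N.S.}:=\max\{c^Tx:x\in P^{N.S.}\}$. *)

(* Defs.v *)
(* MathComp and MathComp-Analysis: the data of a program are rational, its
   points are column vectors over an arbitrary [R : realType]. *)
From HB Require Import structures.
From mathcomp Require Import all_boot all_order all_algebra.
From mathcomp Require Import boolp classical_sets reals convex.

Set Implicit Arguments.
Unset Strict Implicit.
Unset Printing Implicit Defensive.
Import Order.TTheory GRing.Theory Num.Theory.
Local Open Scope classical_set_scope.
Local Open Scope ring_scope.

Record packing_milp (m n : nat) := PackingMilp {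
  lhs : 'M[rat]_(m, n);
  rhs : 'cV[rat]_m;
  obj : 'cV[rat]_n;
  intvars : {set 'I_n};
  lhs_ge0 : forall i j, 0 <= lhs i j;
  rhs_ge0 : forall i, 0 <= rhs i 0;
  obj_ge0 : forall j, 0 <= obj j 0
}.

Definition dotv (R : realType) (n : nat) (u x : 'cV[R]_n) : R :=
  (u^T *m x) 0 0.

(* [is_max f S z] : the maximum of f over S exists and equals z. *)
Definition is_max (R : realType) (n : nat) (f : 'cV[R]_n -> R)
    (S : set 'cV[R]_n) (z : R) : Prop :=
  (f @` S) z /\ ubound (f @` S) z.

Definition convex_hull (R : realType) (n : nat) (S : set 'cV[R]_n) :
    set 'cV[R]_n :=
  smallest (@convex_set R 'cV[R]_n) S.

Section Milp.
Variables (R : realType) (m n : nat) (M : packing_milp m n).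

Definition objective (x : 'cV[R]_n) : R := dotv (map_mx ratr (obj M)) x.

Definition lp_region : set 'cV[R]_n :=
  [set x | (forall i, (map_mx ratr (lhs M) *m x) i 0 <= ratr (rhs M i 0)) /\
           (forall j, 0 <= x j 0)].

Definition milp_region : set 'cV[R]_n :=
  [set x | lp_region x /\ forall j, j \in intvars M -> x j 0 \is a Num.nat].

Definition integer_hull : set 'cV[R]_n := convex_hull milp_region.

Definition sparse_cut (N : {set 'I_n}) (alpha : 'cV[R]_n) (beta : R) : Prop :=
  (forall i, i \notin N -> alpha i 0 = 0) /\
  (forall x, integer_hull x -> dotv alpha x <= beta).

Definition sparse_closure (N : {set 'I_n}) : set 'cV[R]_n :=
  [set x | lp_region x /\
           forall alpha beta, sparse_cut N alpha beta -> dotv alpha x <= beta].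

End Milp.

Arguments integer_hull R {m n} M.

Section Graph.
Variables (m n : nat) (M : packing_milp m n) (J : {set {set 'I_n}}).

Definition row_meets (i : 'I_m) (B : {set 'I_n}) : bool :=
  [exists j in B, lhs M i j != 0].

(* The nodes of the graph are the blocks themselves. *)
Definition block : finType := {B : {set 'I_n} | B \in J}.

Definition pack_graph : rel block := fun u v =>
  (u != v) && [exists i, row_meets i (val u) && row_meets i (val v)].

Definition row_support (i : 'I_m) : {set 'I_n} :=
  (\bigcup_(B in J | row_meets i B) B)%SET.

Definition natural_sparse_closure (R : realType) : set 'cV[R]_n :=
  \bigcap_(i in [set: 'I_m]) sparse_closure M (row_support i).

End Graph.

Arguments pack_graph {m n} M J.
Arguments natural_sparse_closure {m n} M J R.

Definition is_star (T : finType) (e : rel T) (Delta : nat) : Prop :=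
  #|T| = Delta.+1 /\
  exists center : T,
    forall u v, e u v = (u != v) && ((u == center) || (v == center)).

(* Main.v *)
(** The center block has one binary variable x_a for each point a of the affine
    plane over F_p, and each leaf is a single binary variable y_i, tied to a
    parallel class of lines (the classes of distinct leaves being distinct).
    The rows force the support of x into one line of class i when y_i = 1, and
    bound the sum of the x_a by p.  The objective is (Delta - 1) times the sum
    of the x_a plus p times the sum of the y_i.

    If two of the y_i are 1, the support of x lies in two non-parallel lines,
    hence is at most one point, so z^I = p Delta + Delta - 1.  On the other
    hand the point x = (1/p, ..., 1/p), y = (1, ..., 1) agrees, on the center
    and the leaf i, with the average over the p lines of class i of the
    feasible points (indicator of the line, y_i = 1).  It therefore satisfies
    every sparse cut, and z^{N.S.} = p (2 Delta - 1).  Let p go to infinity. *)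
Require Import Defs.
From mathcomp Require Import all_boot all_order all_algebra.
From mathcomp Require Import boolp classical_sets reals convex.
From mathcomp Require Import ring lra interval_inference.
Import Order.TTheory GRing.Theory Num.Theory.
Local Open Scope ring_scope.

(** * Linear bounds on the integer hull *)

Section Preliminaries.
Variable R : realType.

Lemma dotvE (n : nat) (u x : 'cV[R]_n) : dotv u x = \sum_j u j 0 * x j 0.
Proof. by rewrite /dotv mxE; apply: eq_bigr => j _; rewrite mxE. Qed.

Lemma convex_halfspace (n : nat) (u : 'cV[R]_n) (z : R) :
  @convex_set R 'cV[R]_n [set x | dotv u x <= z]%classic.
Proof.
move=> x y l; rewrite !inE /= => hx hy.
have -> : dotv u (conv l x y) = l%:num * dotv u x + (1 - l%:num) * dotv u y.
  rewrite !dotvE !mulr_sumr -big_split /=; apply: eq_bigr => j _.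
  by rewrite !mxE /unstable.onem; ring.
have [l0 l1] : 0 <= l%:num /\ l%:num <= 1 by [].
by nra.
Qed.

(** The half-space is convex and contains the feasible points, hence also their hull. *)
Lemma integer_hull_ub (m n : nat) (M : packing_milp m n) (u : 'cV[R]_n) (z : R) :
  (forall x, milp_region M x -> dotv u x <= z) ->
  forall x, integer_hull R M x -> dotv u x <= z.
Proof.
by move=> Hz; apply: (smallest_sub (X := [set x | dotv u x <= z]%classic)) => //;
  apply: convex_halfspace.
Qed.

Lemma sub_integer_hull (m n : nat) (M : packing_milp m n) (x : 'cV[R]_n) :
  milp_region M x -> integer_hull R M x.
Proof. exact: sub_gen_smallest. Qed.

Lemma nat_ge1 (x : R) : x \is a Num.nat -> x != 0 -> 1 <= x.
Proof. by move=> /natrP[n ->]; rewrite pnatr_eq0 ler1n lt0n. Qed.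

(** At most one term is nonzero. This serves for the x_a when two leaves are on, and for the y_i
    otherwise. *)
Lemma sum_le1 (T : finType) (F : T -> R) :
  (forall a, F a <= 1) ->
  (forall a b, a != b -> F a != 0 -> F b = 0) ->
  \sum_a F a <= 1.
Proof.
move=> F1 F0; have [a Fa|Fz] := pickP (fun a => F a != 0).
  rewrite (bigD1 a) //= big1 ?addr0 // => b ba.
  by apply: (F0 a) => //; rewrite eq_sym.
by rewrite big1 ?ler01 // => a _; have /negbFE/eqP := Fz a.
Qed.

End Preliminaries.

(** * The affine plane over F_p and the program built on it *)

Section Construction.
Variables (R : realType) (D p : nat).
Hypotheses (D_gt0 : (0 < D)%N) (p_prime : prime p) (D_le_p : (D <= p)%N).

Let plane : finType := ('F_p * 'F_p)%type.
Let col : finType := (plane + 'I_D)%type.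
(** [None] bounds the sum of the x_a; [Some (i, a, b)] is x_a + x_b + y_i <= 2 when [a] and [b] lie
    on different lines of class [i]. *)
Let row : finType := option ('I_D * plane * plane).

(** The fibres of [line_of i] are the parallel lines of slope -i. *)
Definition line_of (i : 'I_D) (a : plane) : 'F_p := i%:R * a.1 + a.2.

(** Non-parallel lines meet at most once: subtracting the equations leaves (i - j) a.1, and i - j is
    invertible mod p because i, j < D <= p. *)
Lemma line_of_inj (i j : 'I_D) (a b : plane) : i != j ->
  line_of i a = line_of i b -> line_of j a = line_of j b -> a = b.
Proof.
case: a b => [a1 a2] [b1 b2]; rewrite /line_of /= => ij hi hj.
have ij0 : i%:R - j%:R != 0 :> 'F_p.
  rewrite subr_eq0; apply: contra ij => /eqP/(congr1 val) /=.
  rewrite !val_Fp_nat // !modn_small ?(leq_trans (ltn_ord _)) // => /val_inj.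
  by move->.
have h1 : (i%:R - j%:R) * a1 = (i%:R - j%:R) * b1 :> 'F_p.
  have -> : (i%:R - j%:R) * a1 = (i%:R * a1 + a2) - (j%:R * a1 + a2) by ring.
  by rewrite hi hj; ring.
have e1 := mulfI ij0 h1; rewrite e1 in hi *.
by move/addrI: hi => ->.
Qed.

Lemma line_of_ex (i : 'I_D) : line_of i (0, 0) != line_of i (0, 1).
Proof. by rewrite /line_of /= !mulr0 !add0r eq_sym oner_eq0. Qed.

Lemma card_line (i : 'I_D) (c : 'F_p) :
  \sum_a (line_of i a == c)%:R = p%:R :> R.
Proof.
rewrite -(pair_bigA _ (fun x y => (line_of i (x, y) == c)%:R)) /=.
transitivity (\sum_(x : 'F_p) 1%R : R); last by rewrite sumr_const card_Fp.
apply: eq_bigr => x _; rewrite (bigD1 (c - i%:R * x)) //= big1 => [|y yc].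
  by rewrite /line_of /= addrCA subrr !addr0 eqxx.
by rewrite /line_of /= [_ * _ + y]addrC eq_sym -subr_eq eq_sym (negPf yc).
Qed.

(* The rows with [line_of i a = line_of i b] read [y_i <= 1]. *)
Definition coef (r : row) (t : col) : rat :=
  match r, t with
  | None, inl _ => 1
  | None, inr _ => 0
  | Some (i, a, b), inl c =>
      ((line_of i a != line_of i b) && ((c == a) || (c == b)))%:R
  | Some (i, _, _), inr k => (i == k)%:R
  end.

Definition capacity (r : row) : rat :=
  match r with
  | None => p%:R
  | Some (i, a, b) => 1 + (line_of i a != line_of i b)%:R
  end.

Definition weight (t : col) : rat :=
  match t with inl _ => D.-1%:R | inr _ => p%:R end.

Lemma coef_ge0 (r : 'I_#|row|) (j : 'I_#|col|) :
  0 <= (\matrix_(r, j) coef (enum_val r) (enum_val j)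
         : 'M_(#|row|, #|col|)) r j.
Proof.
rewrite mxE; case: (enum_val r) => [[[i a] b]|]; case: (enum_val j) => c //=;
  exact: ler0n.
Qed.

Lemma capacity_ge0 (r : 'I_#|row|) :
  0 <= (\col_r capacity (enum_val r) : 'cV_#|row|) r 0.
Proof.
by rewrite mxE; case: (enum_val r) => [[[i a] b]|] /=; rewrite ?addr_ge0 ?ler0n.
Qed.

Lemma weight_ge0 (j : 'I_#|col|) :
  0 <= (\col_j weight (enum_val j) : 'cV_#|col|) j 0.
Proof. by rewrite mxE; case: (enum_val j) => c /=; exact: ler0n. Qed.

Definition line_milp : packing_milp #|row| #|col| :=
  @PackingMilp _ _ _ _ _ finset.setT coef_ge0 capacity_ge0 weight_ge0.

(** * Objective and constraints in the coordinates x, y *)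

Let xc (v : 'cV[R]_#|col|) (a : plane) : R := v (enum_rank (inl a : col)) 0.
Let yc (v : 'cV[R]_#|col|) (i : 'I_D) : R := v (enum_rank (inr i : col)) 0.

Lemma sum_col (F : 'I_#|col| -> R) :
  \sum_j F j = \sum_a F (enum_rank (inl a : col))
             + \sum_i F (enum_rank (inr i : col)).
Proof.
rewrite (reindex enum_rank) /=; last exact/onW_bij/enum_rank_bij.
by rewrite big_sumType.
Qed.

Lemma objectiveE (v : 'cV[R]_#|col|) :
  objective line_milp v = D.-1%:R * \sum_a xc v a + p%:R * \sum_i yc v i.
Proof.
rewrite /objective dotvE sum_col !mulr_sumr.
by congr (_ + _); apply: eq_bigr => t _; rewrite !mxE enum_rankK /= ratr_nat.
Qed.

Lemma lhsE (v : 'cV[R]_#|col|) (r : row) :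
  (map_mx ratr (lhs line_milp) *m v) (enum_rank r) 0 =
  match r with
  | None => \sum_a xc v a
  | Some (i, a, b) =>
      (line_of i a != line_of i b)%:R * (xc v a + xc v b) + yc v i
  end.
Proof.
rewrite mxE sum_col.
case: r => [[[i a] b]|].
  congr (_ + _).
    have [ab|/= ab] := boolP (line_of i a == line_of i b).
      by rewrite big1 ?mul0r // => c _; rewrite !mxE !enum_rankK /= ab
        /= ratr_nat mul0r.
    have neq : b != a by apply: contraNN ab => /eqP->.
    rewrite mul1r (bigD1 a) //= (bigD1 b) //= big1 => [|c /andP[/negPf ca /negPf cb]].
      by rewrite !mxE !enum_rankK /= ab !eqxx orbT ratr_nat /= !mul1r addr0.
    by rewrite !mxE !enum_rankK /= ca cb andbF ratr_nat mul0r.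
  rewrite (bigD1 i) //= big1 => [|k /negPf ki].
    by rewrite !mxE !enum_rankK /= eqxx ratr_nat mul1r addr0.
  by rewrite !mxE !enum_rankK /= eq_sym ki ratr_nat mul0r.
rewrite [X in _ + X]big1 ?addr0 => [|i _].
  by apply: eq_bigr => a _; rewrite !mxE !enum_rankK /= rmorph1 mul1r.
by rewrite !mxE !enum_rankK /= rmorph0 mul0r.
Qed.

Lemma lp_regionP (v : 'cV[R]_#|col|) :
  lp_region line_milp v <->
  [/\ \sum_a xc v a <= p%:R, forall i, yc v i <= 1,
      forall i a b, line_of i a != line_of i b -> xc v a + xc v b + yc v i <= 2
    & (forall a, 0 <= xc v a) /\ (forall i, 0 <= yc v i)].
Proof.
split=> [[Hrow v0]|[Hp Hy Hab [x0 y0]]].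
  have {}Hrow r : _ <= _ := Hrow (enum_rank r).
  split.
  - by have := Hrow None; rewrite lhsE mxE enum_rankK /= ratr_nat.
  (* A degenerate row, with both points equal, gives the bound on y_i. *)
  - move=> i; have := Hrow (Some (i, (0, 0), (0, 0))).
    by rewrite lhsE mxE enum_rankK /= eqxx mul0r add0r addr0 rmorph1.
  - move=> i a b ab; have := Hrow (Some (i, a, b)).
    by rewrite lhsE mxE enum_rankK /= ab mul1r (_ : 1 + _ = 2%:R) // ratr_nat.
  - by split=> t; apply: v0.
split=> [r|j]; last first.
  by rewrite -[j]enum_valK; case: (enum_val j) => t; [apply: x0|apply: y0].
rewrite -[r]enum_valK; move: (enum_val r) => {}r.
rewrite lhsE mxE enum_rankK; case: r => [[[i a] b]|] /=; last by rewrite ratr_nat.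
have [ab|ab] /= := boolP (line_of i a == line_of i b).
  by rewrite mul0r add0r addr0 rmorph1.
by rewrite mul1r (_ : 1 + _ = 2%:R) // ratr_nat; apply: Hab.
Qed.

Let vec (f : plane -> R) (g : 'I_D -> R) : 'cV[R]_#|col| :=
  \col_j match enum_val j with inl a => f a | inr i => g i end.

Lemma xc_vec f g a : xc (vec f g) a = f a.
Proof. by rewrite /xc mxE enum_rankK. Qed.

Lemma yc_vec f g i : yc (vec f g) i = g i.
Proof. by rewrite /yc mxE enum_rankK. Qed.

Lemma milp_regionP (v : 'cV[R]_#|col|) :
  milp_region line_milp v <->
  [/\ lp_region line_milp v, forall a, xc v a \is a Num.nat
    & forall i, yc v i \is a Num.nat].
Proof.
split=> [[Hlp Hint]|[Hlp xn yn]].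
  by split=> // t; apply: Hint; rewrite inE.
split=> // j _; rewrite -[j]enum_valK.
by case: (enum_val j) => t; [apply: xn|apply: yn].
Qed.

(** * The integer optimum *)

Lemma milp_objective_le (v : 'cV[R]_#|col|) : milp_region line_milp v ->
  objective line_milp v <= p%:R * D%:R + D.-1%:R.
Proof.
move=> /milp_regionP[/lp_regionP[Hp Hy Hab [x0 y0]] xn yn].
rewrite objectiveE.
have D1 : D%:R = D.-1%:R + 1 :> R by rewrite natr1 prednK.
have D0 : 0 <= D.-1%:R :> R by exact: ler0n.
have p0 : 0 <= p%:R :> R by exact: ler0n.
(* With two nonzero leaves, the x_a sum to at most 1 and the value is at most (D - 1) + p D.
   Otherwise the y_i sum to at most 1 and the value is at most (D - 1) p + p = p D. *)
have [i /existsP[j /and3P[ij yi yj]]|H] :=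
    pickP (fun i => [exists j, [&& i != j, yc v i != 0 & yc v j != 0]]).
  have yi1 := nat_ge1 _ _ (yn i) yi; have yj1 := nat_ge1 _ _ (yn j) yj.
  (* Distinct points are separated by class [i] or class [j]; the row of that class, with its y at
     least 1, leaves at most 1 for the pair. *)
  have pair_le1 a b : a != b -> xc v a + xc v b <= 1.
    move=> ab; have [ei|ni] := eqVneq (line_of i a) (line_of i b); last first.
      by have := Hab i a b ni; lra.
    have [ej|nj] := eqVneq (line_of j a) (line_of j b); last first.
      by have := Hab j a b nj; lra.
    by move: ab; rewrite (line_of_inj i j a b ij ei ej) eqxx.
  have Hx : \sum_a xc v a <= 1.
    apply: sum_le1 => [a|a b ab xa].
      (* Any second point would do: pairing [a] with it yields x_a <= 1. *)
      have ne : a != (a.1 + 1, a.2).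
        by rewrite -pair_eqE /= negb_and -subr_eq0 opprD addNKr oppr_eq0 oner_eq0.
      by have := pair_le1 _ _ ne; have := x0 (a.1 + 1, a.2); lra.
    have := pair_le1 a b ab; have := nat_ge1 _ _ (xn a) xa; have := x0 b.
    by move=> *; apply/eqP; rewrite eq_le; apply/andP; split; lra.
  have Hys : \sum_i yc v i <= D%:R.
    apply: le_trans (ler_sum _ (fun i _ => Hy i)) _.
    by rewrite sumr_const card_ord.
  by rewrite addrC; apply: lerD; [apply: ler_wpM2l
    |rewrite -[leRHS]mulr1; apply: ler_wpM2l].
have Hys : \sum_i yc v i <= 1.
  apply: sum_le1 => // i j ij yi; apply/eqP; apply: contraFT (H i) => yj.
  by apply/existsP; exists j; rewrite ij yi yj.
nra.
Qed.

(** A one-point support lies on a single line of every class, so all leaves can be on. *)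
Definition hull_opt : 'cV[R]_#|col| :=
  vec (fun a => (a == (0, 0))%:R) (fun=> 1).

Lemma hull_opt_sum : \sum_a xc hull_opt a = 1.
Proof.
rewrite (bigD1 (0, 0)) //= big1 => [|a /negPf a0]; rewrite xc_vec ?a0 //.
by rewrite eqxx addr0.
Qed.

Lemma hull_opt_milp : milp_region line_milp hull_opt.
Proof.
apply/milp_regionP; split=> [|a|i]; rewrite ?xc_vec ?yc_vec ?natr_nat //.
apply/lp_regionP; split.
- by rewrite hull_opt_sum ler1n prime_gt0.
- by move=> i; rewrite yc_vec.
- move=> i a b ab; rewrite !xc_vec yc_vec.
  have : a != b by apply: contraNN ab => /eqP->.
  by case: (a =P (0, 0)) => [->|_]; case: (b =P (0, 0)) => [->|_];
    rewrite ?eqxx //= => _; lra.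
- by split=> t; rewrite ?xc_vec ?yc_vec ?ler0n.
Qed.

Lemma hull_opt_objective :
  objective line_milp hull_opt = p%:R * D%:R + D.-1%:R.
Proof.
rewrite objectiveE hull_opt_sum mulr1 addrC; congr (_ * _ + _).
by rewrite (eq_bigr _ (fun i _ => yc_vec _ _ i)) sumr_const card_ord.
Qed.

(** * Indicators of lines and their average *)

Definition line_point (i : 'I_D) (c : 'F_p) : 'cV[R]_#|col| :=
  vec (fun a => (line_of i a == c)%:R) (fun k => (k == i)%:R).

(** Points on different lines of class [i] are not both on line [c]; for any other class y_k = 0,
    and its rows allow x_a = x_b = 1. *)
Lemma line_point_milp (i : 'I_D) (c : 'F_p) :
  milp_region line_milp (line_point i c).
Proof.
apply/milp_regionP; split=> [|a|k]; rewrite ?xc_vec ?yc_vec ?natr_nat //.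
apply/lp_regionP; split.
- by rewrite (eq_bigr _ (fun a _ => xc_vec _ _ a)) card_line.
- by move=> k; rewrite yc_vec; case: eqP.
- move=> k a b ab; rewrite !xc_vec yc_vec.
  case: (k =P i) ab => [->|_] ab.
    case: (line_of i a =P c) ab => [->|_]; case: (line_of i b =P c) => [->|_];
      rewrite ?eqxx //= => _; lra.
  by do 2 case: eqP => _ /=; lra.
- by split=> t; rewrite ?xc_vec ?yc_vec ?ler0n.
Qed.

Definition closure_opt : 'cV[R]_#|col| := vec (fun=> p%:R^-1) (fun=> 1).

Let p_neq0 : p%:R != 0 :> R.
Proof. by rewrite pnatr_eq0 -lt0n prime_gt0. Qed.

Lemma closure_opt_sum : \sum_a xc closure_opt a = p%:R.
Proof.
rewrite (eq_bigr _ (fun a _ => xc_vec _ _ a)) sumr_const card_prod card_Fp //.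
by rewrite -[LHS]mulr_natl natrM mulfK.
Qed.

Lemma closure_opt_lp : lp_region line_milp closure_opt.
Proof.
apply/lp_regionP; split.
- by rewrite closure_opt_sum.
- by move=> i; rewrite yc_vec.
- move=> i a b ab; rewrite !xc_vec yc_vec.
  (* Since p >= 2, 1/p + 1/p + 1 <= 2. *)
  have : p%:R^-1 <= 2%:R^-1 :> R.
    by rewrite lef_pV2 ?posrE ?ltr0n ?prime_gt0 // ler_nat prime_gt1.
  by lra.
- by split=> t; rewrite ?xc_vec ?yc_vec ?invr_ge0 ?ler0n.
Qed.

Lemma closure_opt_objective :
  objective line_milp closure_opt = p%:R * (D.-1%:R + D%:R).
Proof.
rewrite objectiveE closure_opt_sum mulrDr [D.-1%:R * _]mulrC; congr (_ + _ * _).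
by rewrite (eq_bigr _ (fun i _ => yc_vec _ _ i)) sumr_const card_ord.
Qed.

(** The bounds sum x_a <= p and y_i <= 1, both tight at [closure_opt], give this value, so
    [closure_opt] is optimal even for the LP relaxation. *)
Lemma lp_objective_le (v : 'cV[R]_#|col|) : lp_region line_milp v ->
  objective line_milp v <= p%:R * (D.-1%:R + D%:R).
Proof.
move=> /lp_regionP[Hp Hy _ _]; rewrite objectiveE mulrDr [p%:R * D.-1%:R]mulrC.
have Hys : \sum_i yc v i <= D%:R.
  apply: le_trans (ler_sum _ (fun i _ => Hy i)) _.
  by rewrite sumr_const card_ord.
by apply: lerD; apply: ler_wpM2l => //; exact: ler0n.
Qed.

(** Each point of the plane is on exactly one line of class [i], contributing 1 = p (1/p); y_i is 1
    in all p summands; on the other leaves [alpha] vanishes. *)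
Lemma sum_line_point (alpha : 'cV[R]_#|col|) (i : 'I_D) :
  (forall k, k != i -> yc alpha k = 0) ->
  \sum_c dotv alpha (line_point i c) = p%:R * dotv alpha closure_opt.
Proof.
move=> alpha0; pose w j := \sum_c line_point i c j 0.
have -> : \sum_c dotv alpha (line_point i c) = \sum_j alpha j 0 * w j.
  rewrite (eq_bigr _ (fun c _ => dotvE _ _ _ _)) exchange_big /=.
  by apply: eq_bigr => j _; rewrite mulr_sumr.
rewrite dotvE mulr_sumr !sum_col; congr (_ + _); apply: eq_bigr.
  move=> a _; rewrite mulrCA; congr (_ * _).
  have -> : closure_opt (enum_rank (inl a : col)) 0 = p%:R^-1 := xc_vec _ _ a.
  rewrite mulfV // /w (eq_bigr _ (fun c _ => xc_vec _ _ a)).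
  rewrite (bigD1 (line_of i a)) //= big1 => [|c /negPf ca].
    by rewrite eqxx addr0.
  by rewrite eq_sym ca.
move=> k _; have [->|ki] := eqVneq k i; last first.
  have -> : alpha (enum_rank (inr k : col)) 0 = 0 := alpha0 _ ki.
  by rewrite !mul0r mulr0.
rewrite mulrCA; congr (_ * _).
have -> : closure_opt (enum_rank (inr i : col)) 0 = 1 := yc_vec _ _ i.
rewrite mulr1 /w (eq_bigr _ (fun c _ => yc_vec _ _ i)) eqxx.
by rewrite sumr_const card_Fp.
Qed.

(** * The partition and its interaction graph *)

Definition kind (t : col) : option 'I_D :=
  match t with inl _ => None | inr i => Some i end.

Definition block_of (o : option 'I_D) : {set 'I_#|col|} :=
  [set j | kind (enum_val j) == o].

Definition blocks : {set {set 'I_#|col|}} := [set block_of o | o : option 'I_D].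

(** Nonempty fibres make [block_of] injective and keep the empty set out of the partition. *)
Lemma kind_ex (o : option 'I_D) : exists t, kind t = o.
Proof. by case: o => [i|]; [exists (inr i)|exists (inl (0, 0))]. Qed.

Lemma block_of_inj : injective block_of.
Proof.
move=> o o' /setP e; have [t to] := kind_ex o.
by have := e (enum_rank t); rewrite !inE enum_rankK to eqxx => /esym/eqP.
Qed.

Lemma blocks_partition : finset.partition blocks finset.setT.
Proof.
apply/and3P; split.
- apply/eqP/setP => j; rewrite inE; apply/bigcupP.
  by exists (block_of (kind (enum_val j))); rewrite ?imset_f // inE.
- apply/finset.trivIsetP => _ _ /imsetP[o _ ->] /imsetP[o' _ ->].
  apply: contraR => /pred0Pn[j /andP[/=]].
  by rewrite !inE => /eqP-> /eqP->.
- apply/imsetP => -[o _ /setP]; have [t to] := kind_ex o.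
  by move=> /(_ (enum_rank t)); rewrite !inE enum_rankK to eqxx.
Qed.

Lemma row_meets_block_of (r : row) (o : option 'I_D) :
  row_meets line_milp (enum_rank r) (block_of o) =
  [exists t, (kind t == o) && (coef r t != 0)].
Proof.
apply/exists_inP/existsP => [[j]|[t /andP[to rt]]].
  rewrite inE mxE enum_rankK => jo rj; exists (enum_val j).
  by rewrite jo rj.
by exists (enum_rank t); rewrite ?inE ?mxE ?enum_rankK.
Qed.

(** No row involves two different y_i, so leaves are pairwise nonadjacent. *)
Lemma row_meets_leaf (r : row) (i : 'I_D) :
  row_meets line_milp (enum_rank r) (block_of (Some i)) =
  if r is Some (k, _, _) then k == i else false.
Proof.
rewrite row_meets_block_of; apply/existsP/idP => [[[//|k] /=]|].
  case: r => [[[l a] b]|]; last by rewrite /= andbF.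
  by rewrite pnatr_eq0 eqb0 negbK => /andP[/eqP[->]].
case: r => [[[l a] b]|] // /eqP ->; exists (inr i).
by rewrite /= !eqxx oner_eq0.
Qed.

Lemma row_meets_center_leaf (i : 'I_D) : exists r : 'I_#|row|,
  row_meets line_milp r (block_of None) &&
  row_meets line_milp r (block_of (Some i)).
Proof.
(* These two points lie on different lines of every class, so the row does involve x. *)
exists (enum_rank (Some (i, (0, 0), (0, 1)) : row)).
rewrite row_meets_leaf eqxx andbT row_meets_block_of.
by apply/existsP; exists (inl (0, 0)); rewrite /= line_of_ex.
Qed.

Lemma pack_graph_star : is_star (pack_graph line_milp blocks) D.
Proof.
split.
  by rewrite card_sig card_imset ?card_option ?card_ord //; exact: block_of_inj.
have cJ : block_of None \in blocks by exact: imset_f.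
exists (exist (fun B => B \in blocks) _ cJ) => u v.
have [o _ uo] := imsetP (valP u); have [o' _ vo] := imsetP (valP v).
rewrite /pack_graph -!(inj_eq (@val_inj _ _ (block blocks))) /= uo vo.
rewrite !(inj_eq block_of_inj).
have [//|neq] /= := eqVneq o o'.
case: o o' neq {uo vo} => [i|] [k|] //= ik.
- apply/existsP => -[r]; rewrite -[r]enum_valK; move: (enum_val r) => {}r.
  rewrite !row_meets_leaf; case: r => [[[l a] b]|] // /andP[/eqP li /eqP lk].
  by move: ik; rewrite -li lk eqxx.
- by have [r rM] := row_meets_center_leaf i; apply/existsP; exists r; rewrite andbC.
- by have [r rM] := row_meets_center_leaf k; apply/existsP; exists r.
Qed.

(** A cut on the support of a row thus sees at most one leaf, as [sum_line_point] requires. *)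
Lemma row_support_sub (r : 'I_#|row|) : exists i : 'I_D,
  forall k, k != i -> enum_rank (inr k : col) \notin row_support line_milp blocks r.
Proof.
rewrite -[r]enum_valK; move: (enum_val r) => {}r.
(* The sum row meets no leaf; index 0 is a default, available since D >= 1. *)
exists (if r is Some (i, _, _) then i else Ordinal D_gt0) => k.
apply: contraNN => /finset.bigcupP[B /andP[/imsetP[o _ ->]]].
rewrite inE enum_rankK => rB /eqP/= ko; move: rB; rewrite -ko row_meets_leaf.
by case: r => [[[i a] b]|] // /eqP->.
Qed.

(** * The two maxima *)

Lemma closure_opt_natural : natural_sparse_closure line_milp blocks R closure_opt.
Proof.
move=> r _; split; first exact: closure_opt_lp.
move=> alpha beta [alpha0 cut]; have [i ri] := row_support_sub r.
(* Scaled by p, the cut at [closure_opt] is the sum of the cut over the p integral line points. *)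
rewrite -(ler_pM2l (_ : 0 < p%:R)) ?ltr0n ?prime_gt0 //.
rewrite -(sum_line_point _ i) => [|k ki]; last exact/alpha0/ri.
have cut_line c : dotv alpha (line_point i c) <= beta.
  exact: (cut _ (sub_integer_hull _ _ _ _ _ (line_point_milp i c))).
apply: le_trans (ler_sum _ (fun c _ => cut_line c)) _.
by rewrite sumr_const card_Fp // mulr_natl.
Qed.

Lemma integer_hull_max :
  is_max (objective line_milp) (integer_hull R line_milp)
    (p%:R * D%:R + D.-1%:R).
Proof.
split.
  by exists hull_opt; [exact: (sub_integer_hull _ _ _ _ _ hull_opt_milp)
    |exact: hull_opt_objective].
move=> _ [x xI <-]; apply: integer_hull_ub xI => y; exact: milp_objective_le.
Qed.

Lemma natural_sparse_closure_max :
  is_max (objective line_milp) (natural_sparse_closure line_milp blocks R)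
    (p%:R * (D.-1%:R + D%:R)).
Proof.
split.
  by exists closure_opt; [exact: closure_opt_natural|exact: closure_opt_objective].
(* The closure is an intersection over rows; the sum row is picked to extract membership in the LP
   region. *)
by move=> _ [x /(_ (enum_rank None) Logic.I)[xlp _] <-]; exact: lp_objective_le.
Qed.

End Construction.

(** * The ratio for large p *)

Theorem theorem15 (R : realType) (Delta : nat) (eps : R) :
  (1 <= Delta)%N -> 0 < eps ->
  exists (m n : nat) (M : packing_milp m n) (J : {set {set 'I_n}}) (zI zNS : R),
    finset.partition J [set: 'I_n]%SET /\
    is_star (pack_graph M J) Delta /\
    is_max (objective M) (integer_hull R M) zI /\
    is_max (objective M) (natural_sparse_closure M J R) zNS /\
    0 < zI /\
    zNS >= ((2 * Delta%:R - 1) / Delta%:R - eps) * zI.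
Proof.
move=> D_gt0 eps_gt0.
(* p >= Delta keeps the classes distinct, and p >= 2 / eps absorbs the error term. *)
have [p pB p_prime] := prime_above (maxn Delta (Num.truncn (2 / eps)).+1).
have D_le_p : (Delta <= p)%N := leq_trans (leq_maxl _ _) (ltnW pB).
have p_eps : 2 <= p%:R * eps.
  rewrite -ler_pdivrMr //; apply: le_trans (ltW (truncnS_gt _)) _.
  by rewrite ler_nat (leq_trans (leq_maxr _ _) (ltnW pB)).
exists _, _, (line_milp Delta p), (blocks Delta p),
  (p%:R * Delta%:R + Delta.-1%:R), (p%:R * (Delta.-1%:R + Delta%:R)).
split; first exact: blocks_partition.
split; first exact: pack_graph_star.
split; first exact: integer_hull_max.
split; first exact: natural_sparse_closure_max.
have D1 : 1 <= Delta%:R :> R by rewrite ler1n.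
have -> : Delta.-1%:R = Delta%:R - 1 :> R.
  by apply/eqP; rewrite -subr_eq opprK natr1 prednK.
have p1 : 1 <= p%:R :> R by rewrite ler1n prime_gt0.
move: (Delta%:R) (p%:R) D1 p1 p_eps => d q d1 q1 q_eps.
have d_gt0 : 0 < d by lra.
split; first by nra.
rewrite mulrBl lerBlDr mulrAC ler_pdivrMr //.
(* The claim amounts to (2d - 1)(d - 1) <= eps q d^2 + eps d (d - 1); the left side is at most 2
   d^2, which [h2] bounds by eps q d^2. *)
have h1 : 0 <= eps * (d * (d - 1)) by rewrite !mulr_ge0 //; lra.
have h2 : d * d * 2 <= d * d * (q * eps) by rewrite ler_pM2l ?mulr_gt0.
nra.
Qed.
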